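(* In the setting of the context, let $\lambda_0=\inf\{D(f):\mu(f^2)=1,\ f\in\mathscr K\}$. Then $\kappa^{-1}/4\le\lambda_0\le\kappa^{-1}$, where $$\kappa^{-1}=\inf_{1\le n\le m<N+1}\Big[\Big(\sum_{i=1}^n\frac1{\mu_ia_i}\Big)^{-1}+\Big(\sum_{i=m}^N\frac1{\mu_ib_i}\Big)^{-1}\Big]\Big(\sum_{j=n}^m\mu_j\Big)^{-1}.$$ Furthermore, $$\delta_L\wedge\delta_R\ \ge\ \kappa\ \ge\ \big(\mathbb 1_{\{S=\infty\}}+(a_1S)^{-1}\big)\big(\delta_L\wedge\delta_R\big),$$ where $$S=\sum_{i=1}^N\frac1{\mu_ia_i}+\frac1{\mu_Nb_N}\mathbb 1_{\{N<\infty\}},\qquad \delta_L=\sup_{1\le n<N+1}\sum_{i=1}^n\frac1{\mu_ia_i}\sum_{j=n}^N\mu_j,\qquad \delta_R=\sup_{1\le m<N+1}\sum_{j=1}^m\mu_j\sum_{k=m}^N\frac1{\mu_kb_k}.$$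
   Context: $E=\{i\in\mathbb Z:1\le i<N+1\}$, $1\le N\le\infty$, with Dirichlet boundaries at $0$ and, if $N<\infty$, at $N+1$: death rates $a_i>0$ and birth rates $b_i>0$ for all $i\in E$. $\mu_1=1$, $\mu_k=\frac{b_1\cdots b_{k-1}}{a_2\cdots a_k}$ for $2\le k<N+1$; $\mu(f)=\sum_{k\in E}\mu_kf_k$; $\mathscr K$ is the set of finitely supported functions on $E$; $D(f)=\mu_1a_1f_1^2+\sum_{k\in E}\mu_kb_k(f_{k+1}-f_k)^2$, with $f_{N+1}:=0$ if $N<\infty$. Convention $1/\infty=0$. *)

(* Defs.v *)
From HB Require Import structures.
From mathcomp Require Import all_boot all_order all_algebra.
From mathcomp Require Import all_classical all_reals all_analysis.

Set Implicit Arguments.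
Unset Strict Implicit.
Unset Printing Implicit Defensive.

Import Order.TTheory GRing.Theory Num.Theory.

Local Open Scope classical_set_scope.
Local Open Scope ring_scope.

(* The right end [N] is an [option nat], [None] standing for N = oo; the state
   space is E = {i : 1 <= i < N + 1}.  Rates are given on all of [nat], but
   only a_i, b_i with i in E are ever used. *)
Definition state (N : option nat) : pred nat :=
  fun i => (1 <= i)%N && (if N is Some n then (i <= n)%N else true).

Section BirthDeath.
Variables (R : realType) (N : option nat) (a b : nat -> R).

Definition mu (k : nat) : R :=
  (\prod_(1 <= i < k) b i) / (\prod_(2 <= i < k.+1) a i).

Local Open Scope ereal_scope.

Definition mu_sum (f : nat -> R) : \bar R :=
  \sum_(0 <= k <oo | state N k) (mu k * f k)%:E.

(* Functions on E are extended by 0 to [nat]; this is where the convention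
   f_(N+1) = 0 used by [dirichlet] is implemented. *)
Definition fin_supp : set (nat -> R) :=
  [set f | (forall i, ~~ state N i -> f i = 0%R) /\
           finite_set [set i | f i != 0%R]].

Definition dirichlet (f : nat -> R) : \bar R :=
  (mu 1 * a 1 * f 1%N ^+ 2)%:E
  + \sum_(0 <= k <oo | state N k) (mu k * b k * (f k.+1 - f k) ^+ 2)%:E.

Definition lambda0 : \bar R :=
  ereal_inf [set dirichlet f | f in
    [set f | fin_supp f /\ mu_sum (fun k => f k ^+ 2)%R = 1]].

(* Inverse of [\bar R]: +oo^-1 = 0 and 0^-1 = +oo. *)
Definition kappa_inv : \bar R :=
  ereal_inf [set x | exists n m : nat,
    [/\ (1 <= n <= m)%N, state N m &
      x = ((\sum_(1 <= i < n.+1) ((mu i * a i)^-1)%:E)^-1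
           + (\sum_(m <= i <oo | state N i) ((mu i * b i)^-1)%:E)^-1)
          * (\sum_(n <= j < m.+1) (mu j)%:E)^-1]].

Definition kappa : \bar R := kappa_inv^-1.

Definition total_S : \bar R :=
  \sum_(0 <= i <oo | state N i) ((mu i * a i)^-1)%:E
  + (if N is Some n then ((mu n * b n)^-1)%:E else 0).

Definition delta_L : \bar R :=
  ereal_sup [set (\sum_(1 <= i < n.+1) ((mu i * a i)^-1)%:E)
                 * (\sum_(n <= j <oo | state N j) (mu j)%:E)
            | n in [set n | state N n]].

Definition delta_R : \bar R :=
  ereal_sup [set (\sum_(1 <= j < m.+1) (mu j)%:E)
                 * (\sum_(m <= k <oo | state N k) ((mu k * b k)^-1)%:E)
            | m in [set m | state N m]].

End BirthDeath.

(* Main.v *)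
(* Put c_0 = mu_1 a_1 and c_k = mu_k b_k = mu_(k+1) a_(k+1).  Extending f by
   f_0 = 0, D(f) = sum_(k >= 0) c_k (f_(k+1) - f_k)^2 is the energy of a chain of
   conductances, and the sums in kappa become phi_n = sum_(k < n) 1/c_k and
   psi_m = sum_(k >= m) 1/c_k, the resistances to the two ends.

   The upper bound for lambda_0 comes from the function which is harmonic outside
   [n, m] and 1 on it (vanishing beyond a K that tends to N).  For the
   lower bound, let L and T be the running maxima of |f| from the left and from
   the right: |f| <= min(L, T), and an edge on which L grows is never one
   on which T decreases, so the energies of L and T add up to at most D(f).  The quantity sum_i mu_i min(L_i^2, T_i^2) is an
   average of sums of mu over intervals [n, m], each controlled by the definition
   of kappa; what remains is two one-sided Hardy inequalities with constant 4.

   For kappa against delta_L and delta_R, note S = 1/a_1 + psi_1.  If S is finite,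
   restricting to n = 1 gives the lower bound with delta_R alone; if S is infinite,
   so is every psi_m, and kappa = delta_L. *)
Require Import Defs.
From mathcomp Require Import all_boot all_order all_algebra.
From mathcomp Require Import all_classical all_reals all_analysis.
From mathcomp Require Import ring lra zify.

Set Implicit Arguments.
Unset Strict Implicit.
Unset Printing Implicit Defensive.

Import Order.TTheory GRing.Theory Num.Theory.

Local Open Scope ereal_scope.

(** * Hardy inequalities and test functions on a finite chain *)

Section Hardy.
Local Open Scope ring_scope.
Variable R : realFieldType.
Implicit Types (u v w f h c : nat -> R).

(** Induction step of the Hardy inequality, [p] being the weight accumulated so far and [w] the next
    one. The difference of the two sides is a positive combination of two squares. *)
Lemma hardy_step (x y p w : R) : 0 < p -> 0 < w ->
  (y ^+ 2 - x ^+ 2) / (p + w) + y ^+ 2 / (p + w) <=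
  x ^+ 2 / p + 4 * ((y - x) ^+ 2 / w).
Proof.
move=> p0 w0; have q0 : 0 < p + w by exact: addr_gt0.
rewrite -subr_ge0.
have -> : x ^+ 2 / p + 4 * ((y - x) ^+ 2 / w)
    - ((y ^+ 2 - x ^+ 2) / (p + w) + y ^+ 2 / (p + w))
  = ((x * w - 2 * p * (y - x)) ^+ 2 + 2 * p * w * (y - x) ^+ 2)
    / (p * w * (p + w)).
  by field; rewrite ?gt_eqF.
apply: divr_ge0; last by rewrite !mulr_ge0 ?ltW.
apply: addr_ge0; [exact: sqr_ge0|apply: mulr_ge0; [|exact: sqr_ge0]].
by rewrite !mulr_ge0 ?ltW.
Qed.

(** Hardy's inequality with its classical constant 4, before summation by parts. The increments of
    [h ^+ 2] are kept because [coupling_sum] produces exactly such sums. *)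
Lemma hardy_one_sided h w K : h 0%N = 0 ->
  (forall i, (i < K)%N -> 0 < w i) ->
  \sum_(0 <= i < K) (h i.+1 ^+ 2 - h i ^+ 2) / (\sum_(0 <= j < i.+1) w j) <=
  4 * \sum_(0 <= i < K) (h i.+1 - h i) ^+ 2 / w i.
Proof.
move=> h0 w0; pose W i := \sum_(0 <= j < i) w j.
have W0 k : (0 < k <= K)%N -> 0 < W k.
  case: k => //= k kK; rewrite /W big_nat_recr//= ltr_wpDl ?w0//.
  rewrite big_nat; apply: sumr_ge0 => i /andP[_ ik].
  by rewrite ltW// w0// (ltn_trans ik).
(* The extra term [h k ^+ 2 / W k] makes the induction go through. *)
suff H k : (k <= K)%N ->
    \sum_(0 <= i < k) (h i.+1 ^+ 2 - h i ^+ 2) / W i.+1 + h k ^+ 2 / W k <=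
    4 * \sum_(0 <= i < k) (h i.+1 - h i) ^+ 2 / w i.
  apply: le_trans (H _ (leqnn _)); rewrite lerDl.
  case: (posnP K) => [->|K0]; first by rewrite /W big_geq// invr0 mulr0.
  by rewrite divr_ge0 ?sqr_ge0 ?ltW ?W0// K0 leqnn.
elim: k => [|k IH] kK; first by rewrite !big_geq// h0 expr0n/= !mul0r mulr0 addr0.
rewrite !(big_nat_recr k)//= mulrDr.
(* At [k = 0] the accumulated weight is 0, so [hardy_step] does not apply. There the claim reads
   [2 * t <= 4 * t] with [t = h 1 ^+ 2 / w 0]. *)
case: (posnP k) => [k0|k0].
  rewrite k0 !big_geq// /W big_nat1 h0 mulr0 !add0r subr0 expr0n/= subr0.
  have : 0 <= h 1%N ^+ 2 / w 0%N by rewrite divr_ge0 ?sqr_ge0// ltW// w0// -k0.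
  lra.
have := IH (ltnW kK).
have Wk : 0 < W k by rewrite W0// k0 ltnW.
have := hardy_step (h k) (h k.+1) Wk (w0 _ kK).
have -> : W k + w k = W k.+1 by rewrite /W big_nat_recr.
lra.
Qed.

(** A layer-cake argument in two variables: writing [min (u i) (v i)] as the mass of the pairs
    [(n, m)] with [n <= i <= m] turns the left side into a weighted sum of interval sums of [mu]. *)
Lemma coupling_sum (mu u v A B : nat -> R) K :
  u 0%N = 0 -> v K.+1 = 0 ->
  (forall i, 0 <= u i) -> (forall i, 0 <= v i) ->
  (forall i, (i <= K)%N -> u i <= u i.+1) ->
  (forall i, (i <= K)%N -> v i.+1 <= v i) ->
  (forall n, (1 <= n <= K)%N -> 0 <= A n) ->
  (forall n, (1 <= n <= K)%N -> 0 <= B n) ->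
  (forall n m, (1 <= n <= m)%N -> (m <= K)%N ->
     \sum_(n <= j < m.+1) mu j <= A n + B m) ->
  \sum_(1 <= i < K.+1) mu i * Num.min (u i) (v i) <=
  \sum_(1 <= n < K.+1) (u n - u n.-1) * A n +
  \sum_(1 <= m < K.+1) (v m - v m.+1) * B m.
Proof.
move=> u0 vK u_ge0 v_ge0 umon vmon A0 B0 H.
(* [p] couples the increments of [u] and [v] monotonically: its marginals are at
   most these increments, and its mass on [n <= i <= m] is [min (u i) (v i)]. *)
pose F (x y : R) := Num.min x y.
pose G n m := F (u n) (v m) - F (u n) (v m.+1).
pose p n m := G n m - G n.-1 m.
(* [p] is a mixed second difference of [min], and [min] is supermodular. *)
have p_ge0 n m : (1 <= n <= K)%N -> (1 <= m <= K)%N -> 0 <= p n m.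
  move=> /andP[n0 nK] /andP[m0 mK].
  have := vmon _ mK; have := umon n.-1;
    rewrite prednK// => /(_ (leq_trans (leq_pred n) nK)).
  rewrite /p /G /F /Num.min; do 4 case: ifP; lra.
have sum_m n a : (a <= K.+1)%N ->
    \sum_(a <= m < K.+1) p n m = F (u n) (v a) - F (u n.-1) (v a).
  move=> aK; rewrite /p sumrB.
  under eq_bigr do rewrite /G -opprB.
  under [X in _ - X]eq_bigr do rewrite /G -opprB.
  rewrite !sumrN !telescope_sumr// vK /F.
  have E x : 0 <= x -> Num.min x 0 = 0 :> R by move=> x0; exact: min_r.
  by rewrite !E//; ring.
have sum_n m a : \sum_(1 <= n < a.+1) p n m = G a m.
  rewrite big_add1/= telescope_sumr//.
  have -> : G 0%N m = 0 by rewrite /G /F u0 !min_l// subrr.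
  exact: subr0.
have E1 i : (1 <= i <= K)%N ->
    Num.min (u i) (v i) =
    \sum_(1 <= n < K.+1 | (n <= i)%N) \sum_(1 <= m < K.+1 | (i <= m)%N) p n m.
  move=> /andP[i1 iK].
  transitivity (\sum_(i <= m < K.+1) G i m).
    rewrite /G; under eq_bigr do rewrite -opprB.
    by rewrite sumrN telescope_sumr ?(leqW iK)// opprB vK /F (min_r (u_ge0 i)) subr0.
  under eq_bigr do rewrite -sum_n.
  rewrite exchange_big/=.
  rewrite (big_nat_widen 1 i.+1 K.+1)//=.
  apply: eq_bigr => n _.
  rewrite (big_nat_widenl i 1)//=.
(* Fubini: [i] is summed first, for a fixed pair [(n, m)]. *)
have -> : \sum_(1 <= i < K.+1) mu i * Num.min (u i) (v i) =
    \sum_(1 <= n < K.+1) \sum_(1 <= m < K.+1) p n m * (\sum_(n <= j < m.+1) mu j).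
  transitivity (\sum_(1 <= i < K.+1) \sum_(1 <= n < K.+1) \sum_(1 <= m < K.+1)
      (if (n <= i <= m)%N then p n m * mu i else 0)).
    rewrite !big_nat; apply: eq_bigr => i iK; rewrite E1// mulr_sumr big_mkcond/=.
    apply: eq_bigr => n _; case: ifP => [ni|_]; last by rewrite big1.
    rewrite mulr_sumr big_mkcond; apply: eq_bigr => m _.
    by case: ifP => // _; rewrite mulrC.
  rewrite exchange_big/=; rewrite !big_nat; apply: eq_bigr => n /andP[n1 _].
  rewrite exchange_big/=; rewrite !big_nat; apply: eq_bigr => m /andP[_ mK].
  rewrite mulr_sumr (big_nat_widenl n 1)//= [RHS](big_nat_widen 1 m.+1 K.+1)//=.
  by rewrite [RHS]big_mkcond/=; apply: eq_bigr => i _; rewrite ltnS.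
apply: (@le_trans _ _ (\sum_(1 <= n < K.+1) \sum_(1 <= m < K.+1) p n m * (A n + B m))).
  rewrite big_nat [leRHS]big_nat; apply: ler_sum => n /andP[n1 nK].
  rewrite big_nat [leRHS]big_nat; apply: ler_sum => m /andP[m1 mK].
  apply: ler_wpM2l; first by rewrite p_ge0 ?n1 ?m1.
  (* For [n > m] the interval is empty, and the signs of [A] and [B] suffice. *)
  case: (leqP n m) => nm; first by rewrite H ?n1.
  by rewrite big_geq// addr_ge0 ?A0 ?B0 ?n1 ?m1.
under eq_bigr do under eq_bigr do rewrite mulrDr.
under eq_bigr do rewrite big_split/=.
rewrite big_split/=; apply: lerD.
  rewrite big_nat [leRHS]big_nat; apply: ler_sum => n /andP[n1 nK].
  rewrite -mulr_suml; apply: ler_wpM2r; first by rewrite ?A0 ?B0 ?n1 ?m1.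
  (* The marginal of [p] at [n] is an increment of [min _ (v 1)], hence at most that of [u], as
     [min] is 1-Lipschitz in each argument. *)
  rewrite sum_m//.
  have := umon n.-1;
    rewrite prednK// => /(_ (leq_trans (leq_pred n) nK)).
  by rewrite /F /Num.min; do 2 case: ifP; lra.
rewrite exchange_big/= big_nat [leRHS]big_nat; apply: ler_sum => m /andP[m1 mK].
rewrite -mulr_suml; apply: ler_wpM2r; first by rewrite ?A0 ?B0 ?n1 ?m1.
rewrite sum_n /G /F; have := vmon _ mK.
by rewrite /Num.min; do 2 case: ifP; lra.
Qed.

(** If both maxima changed on the edge, then [x <= L < y <= T < x]. A single change is at most the
    jump from [x] to [y]. *)
Lemma running_max_edge (L x y T : R) : x <= L -> y <= T ->
  (Num.max L y - L) ^+ 2 + (Num.max x T - T) ^+ 2 <= (y - x) ^+ 2.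
Proof.
move=> xL yT; case: (ltP L y) => Ly; case: (ltP x T) => xT.
- nra.
- lra.
- by rewrite !subrr expr0n/= addr0 sqr_ge0.
- nra.
Qed.

Fixpoint running_max (g : nat -> R) i : R :=
  if i is j.+1 then Num.max (running_max g j) (g i) else g 0%N.

(** The lower bound for a chain grounded at [0] and [K.+1]: the hypothesis places [C] below every
    term of the infimum defining [kappa_inv] for this chain. *)
Lemma two_sided_hardy c (mu f : nat -> R) K (C : R) : 0 <= C ->
  (forall k, (k <= K)%N -> 0 < c k) -> (forall k, (1 <= k <= K)%N -> 0 <= mu k) ->
  (forall n m, (1 <= n <= m)%N -> (m <= K)%N ->
     C * \sum_(n <= j < m.+1) mu j <=
     (\sum_(0 <= k < n) (c k)^-1)^-1 + (\sum_(m <= k < K.+1) (c k)^-1)^-1) ->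
  f 0%N = 0 -> f K.+1 = 0 ->
  C * \sum_(1 <= i < K.+1) mu i * f i ^+ 2 <=
  4 * \sum_(0 <= k < K.+1) c k * (f k.+1 - f k) ^+ 2.
Proof.
move=> C0 c0 mu0 H f0 fK.
pose L := running_max (fun j => `|f j|).
pose T i := running_max (fun j => `|f (K.+1 - j)%N|) (K.+1 - i).
have LS i : L i.+1 = Num.max (L i) `|f i.+1| by [].
have TS i : (i <= K)%N -> T i = Num.max `|f i| (T i.+1).
  move=> iK; rewrite /T subSS subSn//= maxC; congr (Num.max `|f _| _).
  by rewrite subSS subKn.
have L0 : L 0%N = 0 by rewrite /L/= f0 normr0.
have TK : T K.+1 = 0 by rewrite /T subnn/= subn0 fK normr0.
have fL i : `|f i| <= L i.
  by case: i => [|i]; rewrite ?f0 ?normr0 ?L0// LS le_max lexx orbT.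
have fT i : (i <= K.+1)%N -> `|f i| <= T i.
  rewrite leq_eqVlt => /orP[/eqP->|]; first by rewrite TK fK normr0.
  by rewrite ltnS => iK; rewrite TS// le_max lexx.
have L_ge0 i : 0 <= L i by exact: le_trans (fL i).
have T_ge0 i : 0 <= T i.
  by rewrite /T; case: (K.+1 - i)%N => [|j]/=; rewrite ?le_max normr_ge0 ?orbT.
have LS_le i : L i <= L i.+1 by rewrite LS le_max lexx.
have TS_le i : (i <= K)%N -> T i.+1 <= T i.
  by move=> iK; rewrite (TS i)// le_max lexx orbT.
have sq x y : 0 <= x -> x <= y -> x ^+ 2 <= y ^+ 2 :> R.
  by move=> x0 xy; rewrite ler_sqr// nnegrE// (le_trans x0).
have edge k : (k <= K)%N ->
    (L k.+1 - L k) ^+ 2 + (T k - T k.+1) ^+ 2 <= (f k.+1 - f k) ^+ 2.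
  move=> kK; rewrite LS (TS k)//.
  apply: le_trans (running_max_edge (fL k) (fT k.+1 kK)) _.
  (* Replacing [f] by its absolute value does not increase differences along edges. *)
  rewrite -(real_normK (num_real (f _ - f _))) -(real_normK (num_real (_ - `|_|))).
  by apply: sq => //; exact: ler_dist_dist.
have inv_ge0 a b : (b <= K.+1)%N -> 0 <= (\sum_(a <= k < b) (c k)^-1)^-1.
  move=> bK; rewrite invr_ge0 big_nat sumr_ge0// => k /andP[_ kb].
  by rewrite invr_ge0 ltW// c0// -ltnS (leq_trans kb).
apply: (@le_trans _ _ (\sum_(1 <= i < K.+1)
    (C * mu i) * Num.min (L i ^+ 2) (T i ^+ 2))).
  rewrite mulr_sumr !big_nat; apply: ler_sum => i /andP[i1 iK].
  rewrite mulrA; apply: ler_wpM2l; first by rewrite mulr_ge0// mu0// i1.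
  rewrite -(real_normK (num_real (f i))) le_min !sq// fT// ltnW//.
apply: le_trans (@coupling_sum (fun i => C * mu i) (fun i => L i ^+ 2)
    (fun i => T i ^+ 2) (fun n => (\sum_(0 <= k < n) (c k)^-1)^-1)
    (fun m => (\sum_(m <= k < K.+1) (c k)^-1)^-1) K _ _ _ _ _ _ _ _ _) _.
- by rewrite L0 expr0n.
- by rewrite TK expr0n.
- by move=> i; exact: sqr_ge0.
- by move=> i; exact: sqr_ge0.
- by move=> i _; exact: sq.
- by move=> i iK; apply: sq => //; exact: TS_le.
- by move=> n /andP[_ nK]; apply: inv_ge0; rewrite leqW.
- by move=> m _; exact: inv_ge0.
- by move=> n m nm mK; rewrite -mulr_sumr; exact: H.
apply: (@le_trans _ _ (4 * \sum_(0 <= k < K.+1) c k * (L k.+1 - L k) ^+ 2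
    + 4 * \sum_(0 <= k < K.+1) c k * (T k - T k.+1) ^+ 2)); last first.
  rewrite -mulrDr ler_wpM2l// -big_split/= !big_nat.
  apply: ler_sum => k /andP[_ kK]; rewrite -mulrDr ler_wpM2l ?edge//.
  by rewrite ltW ?c0.
apply: lerD.
- have := @hardy_one_sided L (fun k => (c k)^-1) K.+1 L0.
  have -> : \sum_(0 <= i < K.+1) (L i.+1 - L i) ^+ 2 / (c i)^-1 =
     \sum_(0 <= k < K.+1) c k * (L k.+1 - L k) ^+ 2.
    by apply: eq_bigr => i _; rewrite invrK mulrC.
  have cw i : (i < K.+1)%N -> 0 < (c i)^-1 by move=> iK; rewrite invr_gt0 c0.
  move=> /(_ cw); apply: le_trans.
  (* The Hardy sum has one further term, at edge [K]; it is nonnegative. *)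
  rewrite big_add1/= (big_nat_recr K)//= lerDl.
  by rewrite mulr_ge0 ?inv_ge0// subr_ge0 sq.
(* Reflecting the chain makes [T] vanish at 0; edge [k] goes to edge [K - k]. *)
- have := @hardy_one_sided (fun i => T (K.+1 - i)%N) (fun k => (c (K - k)%N)^-1) K.+1.
  rewrite subn0 TK => /(_ erefl).
  have -> : \sum_(0 <= i < K.+1) (T (K.+1 - i.+1)%N - T (K.+1 - i)%N) ^+ 2
       / (c (K - i)%N)^-1 = \sum_(0 <= k < K.+1) c k * (T k - T k.+1) ^+ 2.
    rewrite [RHS]big_nat_rev/= !big_nat; apply: eq_bigr => i /andP[_ iK].
    by rewrite invrK mulrC add0n subSS subSn.
  have cw i : (i < K.+1)%N -> 0 < (c (K - i)%N)^-1.
    by move=> iK; rewrite invr_gt0 c0 ?leq_subr.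
  move=> /(_ cw); apply: le_trans.
  have rev_sum m : (m <= K)%N -> \sum_(0 <= j < (K - m).+1) (c (K - j)%N)^-1
      = \sum_(m <= k < K.+1) (c k)^-1.
    move=> mK; rewrite [RHS]big_nat_rev -{2}[m]add0n big_addn subSn//=.
    by apply: eq_bigr => j _; congr (c _)^-1; lia.
  rewrite [leRHS]big_nat_rev/= add0n [leRHS]big_ltn//=.
  rewrite ler_wpDl//.
    rewrite subn1/= subnn subSn// subnn; have /= := @rev_sum 0%N isT.
    rewrite subn0 => ->; rewrite divr_ge0 ?subr_ge0 ?sq ?TS_le//.
    by rewrite -invr_ge0 inv_ge0.
  rewrite !big_nat; apply: ler_sum => i /andP[i1 iK].
  by rewrite subSS rev_sum// subSS subKn// subSn ?leq_subr// subKn.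
Qed.

(** A unit drop of potential across resistances in series costs the inverse of their sum, and the
    plateau from [n] to [m] costs nothing. *)
Lemma trapezoid_test_function c (mu : nat -> R) n m K :
  (1 <= n <= m)%N -> (m <= K)%N ->
  (forall k, (k <= K)%N -> 0 < c k) -> (forall k, (1 <= k <= K)%N -> 0 <= mu k) ->
  exists f : nat -> R, [/\ f 0%N = 0, forall i, (K < i)%N -> f i = 0,
    \sum_(n <= j < m.+1) mu j <= \sum_(1 <= i < K.+1) mu i * f i ^+ 2 &
    \sum_(0 <= k < K.+1) c k * (f k.+1 - f k) ^+ 2 =
     (\sum_(0 <= k < n) (c k)^-1)^-1 + (\sum_(m <= k < K.+1) (c k)^-1)^-1].
Proof.
move=> /andP[n1 nm] mK c0 mu0.
pose phi i := \sum_(0 <= k < i) (c k)^-1.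
pose psi i := \sum_(i <= k < K.+1) (c k)^-1.
have phi0 : phi n != 0.
  rewrite gt_eqF// /phi -(prednK n1) big_nat_recr//=.
  rewrite ltr_wpDl ?invr_gt0 ?c0//; last by lia.
  rewrite big_nat; apply: sumr_ge0 => i /andP[_ ik].
  by rewrite invr_ge0 ltW// c0//; lia.
have psi0 : psi m != 0.
  rewrite gt_eqF// /psi big_ltn// ltr_wpDr ?invr_gt0 ?c0//.
  rewrite big_nat; apply: sumr_ge0 => i /andP[_ ik].
  by rewrite invr_ge0 ltW// c0//; lia.
pose f i := if (i <= n)%N then phi i / phi n else if (i <= m)%N then 1 else psi i / psi m.
have f1 i : (n <= i <= m)%N -> f i = 1.
  move=> /andP[ni im]; rewrite /f im; case: leqP => // i_n.
  by rewrite (_ : i = n) ?divff//; lia.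
exists f; split.
- by rewrite /f/= /phi big_geq// mul0r.
- move=> i Ki; have mi := leq_ltn_trans mK Ki.
  rewrite /f leqNgt (leq_ltn_trans nm mi)/= leqNgt mi/=.
  by rewrite /psi big_geq// mul0r.
- rewrite (big_nat_widen _ _ K.+1)// (big_nat_widenl _ 1)// big_mkcond/= !big_nat.
  apply: ler_sum => i /andP[i1 iK]; case: ifP => [|_].
    by move=> /andP[im ni]; rewrite f1 ?ni// expr1n mulr1.
  by rewrite mulr_ge0 ?sqr_ge0 ?mu0// i1.
have cK k : (k <= K)%N -> c k != 0 by move=> kK; rewrite gt_eqF ?c0.
rewrite (@big_cat_nat _ _ _ n)//=; last by lia.
rewrite (@big_cat_nat _ _ _ m n)//=; last by lia.
rewrite [X in _ + (X + _)]big_nat [X in _ + (X + _)]big1 ?add0r; last first.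
  by move=> i /andP[ni im]; rewrite !f1 ?subrr ?expr0n ?mulr0//; lia.
congr (_ + _).
(* Writing [1 / phi n] as [phi n / phi n ^+ 2] allows a comparison edge by edge. *)
- rewrite -/(phi n) -[RHS]mul1r -{1}(divff phi0) -mulrA {1}/phi mulr_suml !big_nat.
  apply: eq_bigr => k /andP[_ kn].
  rewrite /f kn ltnW// {1}/phi big_nat_recr//= -/(phi k).
  by field; rewrite phi0 cK//; lia.
- rewrite -/(psi m) -[RHS]mul1r -{1}(divff psi0) -mulrA {1}/psi mulr_suml !big_nat.
  apply: eq_bigr => k /andP[mk kK].
  have fk i : (m <= i)%N -> f i = psi i / psi m.
    rewrite leq_eqVlt => /orP[/eqP<-|mi]; first by rewrite divff// f1// nm leqnn.
    by rewrite /f leqNgt (leq_ltn_trans nm mi)/= leqNgt mi.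
  rewrite !fk ?leqW// [psi k]/psi big_ltn//= -/(psi k.+1).
  by field; rewrite psi0 cK.
Qed.

End Hardy.

(** * Series over the state space and their truncations *)

Section StateSums.
Variables (R : realType) (N : option nat).
Implicit Types (g : nat -> R) (i k m K : nat).

Lemma state_le K i : state N K -> (1 <= i <= K)%N -> state N i.
Proof.
rewrite /state => /andP[_ KN] /andP[-> iK]/=.
by case: N KN => // p; exact: leq_trans.
Qed.

Lemma state_gt0 K : state N K -> (0 < K)%N. Proof. by case/andP. Qed.

Lemma eseries_state0 g :
  \sum_(0 <= i <oo | state N i) (g i)%:E = \sum_(1 <= i <oo | state N i) (g i)%:E.
Proof.
rewrite [RHS]eseries_cond; apply: eq_eseriesl => i.
by rewrite andb_idr// => /state_gt0.
Qed.

Lemma sum_state g m K : (1 <= m)%N -> state N K ->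
  (\sum_(m <= i < K.+1 | state N i) g i = \sum_(m <= i < K.+1) g i)%R.
Proof.
move=> m1 NK; rewrite big_nat_cond [RHS]big_nat; apply: eq_bigl => i.
rewrite andb_idr// => /andP[mi iK]; apply: (state_le NK).
by rewrite (leq_trans m1).
Qed.

Lemma eseries_state_split g m K : (1 <= m <= K.+1)%N -> state N K ->
  (forall i, state N i -> (0 <= g i)%R) ->
  \sum_(m <= i <oo | state N i) (g i)%:E =
  (\sum_(m <= i < K.+1) g i)%:E + \sum_(K.+1 <= i <oo | state N i) (g i)%:E.
Proof.
move=> /andP[m1 mK] NK g0.
rewrite (nneseries_split_cond m (K.+1 - m)) ?subnKC// sumEFin.
by rewrite (sum_state g m1 NK).
Qed.

Lemma eseries_state_finite g m K : (1 <= m <= K.+1)%N -> state N K ->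
  (forall i, state N i -> (0 <= g i)%R) ->
  (forall i, state N i -> (K < i)%N -> g i = 0%R) ->
  \sum_(m <= i <oo | state N i) (g i)%:E = (\sum_(m <= i < K.+1) g i)%:E.
Proof.
move=> mK NK g0 gK; rewrite (eseries_state_split mK NK)//.
by rewrite eseries0 ?adde0// => i Ki Ni; rewrite gK.
Qed.

Lemma eseries_state_ge g m K : (1 <= m <= K.+1)%N -> state N K ->
  (forall i, state N i -> (0 <= g i)%R) ->
  (\sum_(m <= i < K.+1) g i)%:E <= \sum_(m <= i <oo | state N i) (g i)%:E.
Proof.
move=> mK NK g0; rewrite (eseries_state_split mK NK)// leeDl//.
by apply: nneseries_ge0 => i _ Ni; rewrite lee_fin g0.
Qed.

(** Partial sums ending at a state need no filter, so this form treats finite and infinite [N]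
    alike. *)
Lemma eseries_state_le g m x : state N m ->
  (forall i, state N i -> (0 <= g i)%R) ->
  (forall K, (m <= K)%N -> state N K -> (\sum_(m <= i < K.+1) g i)%:E <= x) ->
  \sum_(m <= i <oo | state N i) (g i)%:E <= x.
Proof.
move=> Nm g0 H; have m1 := state_gt0 Nm.
have [[p Np]|Nnone] : (exists p, N = Some p) \/ N = None.
  by case: N; [left; eexists|right].
  have mp : (m <= p)%N by move: Nm; rewrite Np => /andP[].
  have NNp : state N p by rewrite Np /state leqnn (leq_trans m1).
  rewrite (@eseries_state_finite g m p)//; first exact: H.
    by rewrite m1 leqW.
  by move=> i; rewrite Np => /andP[_ ip]; rewrite ltnNge ip.
apply: lime_le; first by apply: is_cvg_nneseries => i _ Ni; rewrite lee_fin g0.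
near=> n; have mn : (m < n)%N by near: n; exact: nbhs_infty_gt.
have NK : state N n.-1 by rewrite Nnone /state andbT; lia.
rewrite -(prednK (leq_ltn_trans (leq0n _) mn)) sumEFin sum_state//.
by apply: H => //; lia.
Unshelve. all: by end_near. Qed.

End StateSums.

(** * Reversibility and resistances of the birth-death chain *)

Section BirthDeathBounds.
Variables (R : realType) (N : option nat) (a b : nat -> R).
Hypothesis hN : if N is Some n then (1 <= n)%N else true.
Hypothesis ha : forall i, state N i -> (0 < a i)%R.
Hypothesis hb : forall i, state N i -> (0 < b i)%R.
Local Notation mu := (mu a b).

Lemma state1 : state N 1%N.
Proof. by rewrite /state; case: N hN. Qed.

Lemma mu1 : mu 1%N = 1%R.
Proof. by rewrite /mu !big_geq// divr1. Qed.

Lemma mu_gt0 k : state N k -> (0 < mu k)%R.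
Proof.
move=> Nk; rewrite /mu divr_gt0//.
  rewrite big_nat prodr_gt0// => i /andP[i1 ik].
  by rewrite hb// (state_le Nk)// i1 ltnW.
rewrite big_nat prodr_gt0// => i /andP[i1 ik].
by rewrite ha// (state_le Nk)//; lia.
Qed.

Definition conductance k : R := if k is 0%N then (mu 1%N * a 1%N)%R else (mu k * b k)%R.

(** Detailed balance: the conductance of an edge can be read from either endpoint, so the sums over
    [a] and over [b] involve the same resistances. *)
Lemma mu_aE k : state N k.+1 -> (mu k.+1 * a k.+1 = conductance k)%R.
Proof.
case: k => [//|k] Nk; rewrite /conductance /mu.
have a0 : a k.+2 != 0%R by rewrite gt_eqF// ha.
rewrite big_nat_recr//= [X in (_ / X * _)%R]big_nat_recr//= invfM.
by rewrite mulrA divfK// mulrAC.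
Qed.

Lemma conductance_gt0 K k : state N K -> (k <= K)%N -> (0 < conductance k)%R.
Proof.
move=> NK kK; case: k kK => [_|k kK].
  by rewrite /conductance mulr_gt0 ?mu_gt0 ?ha// state1.
by rewrite /conductance mulr_gt0 ?mu_gt0 ?hb// (state_le NK).
Qed.

Lemma conductanceV_ge0 k : state N k -> (0 <= (mu k * b k)^-1)%R.
Proof. by move=> Nk; rewrite invr_ge0 ltW// mulr_gt0 ?mu_gt0 ?hb. Qed.

Lemma conductanceE k : (0 < k)%N -> conductance k = (mu k * b k)%R.
Proof. by case: k. Qed.

Lemma sum_conductanceE m K : (0 < m)%N ->
  (\sum_(m <= i < K) (mu i * b i)^-1 = \sum_(m <= i < K) (conductance i)^-1)%R.
Proof.
move=> m0; rewrite !big_nat; apply: eq_bigr => i /andP[mi _].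
by rewrite conductanceE// (leq_trans m0).
Qed.

Definition phi n : R := (\sum_(0 <= k < n) (conductance k)^-1)%R.
Definition psi_upto K m : R := (\sum_(m <= k < K.+1) (conductance k)^-1)%R.
Definition psi m : \bar R := \sum_(m <= i <oo | state N i) ((mu i * b i)^-1)%:E.

Lemma phiE n : state N n ->
  \sum_(1 <= i < n.+1) ((mu i * a i)^-1)%:E = (phi n)%:E.
Proof.
move=> Nn; rewrite sumEFin big_add1/= /phi; congr _%:E.
rewrite !big_nat; apply: eq_bigr => i /andP[_ ik].
by rewrite mu_aE// (state_le Nn).
Qed.

Lemma sum_conductanceV_gt0 m K n : state N K -> (n <= K.+1)%N -> (m < n)%N ->
  (0 < \sum_(m <= k < n) (conductance k)^-1)%R.
Proof.
move=> NK nK mn; rewrite big_ltn// ltr_wpDr//; last first.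
  by rewrite invr_gt0 (conductance_gt0 NK)// -ltnS (leq_trans mn).
rewrite big_nat sumr_ge0// => i /andP[_ i_n].
by rewrite invr_ge0 ltW// (conductance_gt0 NK)// -ltnS (leq_trans i_n).
Qed.

Lemma phi_gt0 n : state N n -> (0 < phi n)%R.
Proof. by move=> Nn; rewrite (sum_conductanceV_gt0 Nn)// (state_gt0 Nn). Qed.

Lemma psi_upto_gt0 K m : state N K -> (m <= K)%N -> (0 < psi_upto K m)%R.
Proof. by move=> NK mK; rewrite (sum_conductanceV_gt0 NK). Qed.

Lemma psi_ge K m : state N K -> (1 <= m <= K)%N -> (psi_upto K m)%:E <= psi m.
Proof.
move=> NK /andP[m1 mK]; rewrite /psi_upto -sum_conductanceE//.
by apply: eseries_state_ge => //; [rewrite m1 leqW|exact: conductanceV_ge0].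
Qed.

Lemma psi_gt0 m : state N m -> 0 < psi m.
Proof.
move=> Nm; have := @psi_ge m m Nm; rewrite leqnn (state_gt0 Nm) => /(_ isT).
by apply: lt_le_trans; rewrite lte_fin psi_upto_gt0.
Qed.

Lemma psi_le m x : state N m ->
  (forall K, state N K -> (m <= K)%N -> (psi_upto K m)%:E <= x) -> psi m <= x.
Proof.
move=> Nm H; apply: eseries_state_le => // [i|K mK NK]; first exact: conductanceV_ge0.
by rewrite sum_conductanceE ?(state_gt0 Nm)//; exact: H.
Qed.

Lemma sum_mu_gt0 n m : (1 <= n <= m)%N -> state N m ->
  (0 < \sum_(n <= j < m.+1) mu j)%R.
Proof.
move=> /andP[n1 nm] Nm; rewrite big_ltn// ltr_wpDr//; last first.
  by rewrite mu_gt0// (state_le Nm)// n1.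
rewrite big_nat sumr_ge0// => i /andP[ni im].
by rewrite ltW// mu_gt0// (state_le Nm)//; lia.
Qed.

Lemma kappa_termE n m : (1 <= n <= m)%N -> state N m ->
  ((\sum_(1 <= i < n.+1) ((mu i * a i)^-1)%:E)^-1
    + (\sum_(m <= i <oo | state N i) ((mu i * b i)^-1)%:E)^-1)
  * (\sum_(n <= j < m.+1) (mu j)%:E)^-1 =
  (((phi n)^-1)%:E + (psi m)^-1) * ((\sum_(n <= j < m.+1) mu j)^-1)%:E.
Proof.
move=> nm Nm; have Nn : state N n by rewrite (state_le Nm).
by rewrite phiE// sumEFin !inver !gt_eqF// ?phi_gt0 ?sum_mu_gt0.
Qed.

(** * Finitely supported functions and the two bounds for [lambda0] *)

Lemma mu_sumE K f : state N K -> (forall i, (K < i)%N -> f i = 0%R) ->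
  mu_sum N a b (fun k => f k ^+ 2)%R = (\sum_(1 <= k < K.+1) mu k * f k ^+ 2)%:E.
Proof.
move=> NK fK; rewrite /mu_sum eseries_state0 (@eseries_state_finite _ _ _ 1 K)//.
  by move=> i Ni; rewrite mulr_ge0 ?sqr_ge0// ltW// mu_gt0.
by move=> i _ Ki; rewrite fK// expr0n mulr0.
Qed.

Lemma dirichletE K f : state N K -> f 0%N = 0%R ->
  (forall i, (K < i)%N -> f i = 0%R) ->
  dirichlet N a b f = (\sum_(0 <= k < K.+1) conductance k * (f k.+1 - f k) ^+ 2)%:E.
Proof.
move=> NK f0 fK; rewrite /dirichlet eseries_state0 (@eseries_state_finite _ _ _ 1 K)//.
- rewrite -EFinD [in RHS]big_ltn// f0 subr0; congr (_ + _)%:E.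
  by rewrite !big_nat; apply: eq_bigr => i /andP[i1 _]; rewrite conductanceE.
- by move=> i Ni; rewrite mulr_ge0 ?sqr_ge0// ltW// mulr_gt0 ?mu_gt0 ?hb.
- by move=> i _ Ki; rewrite !fK ?leqW// subrr expr0n mulr0.
Qed.

Lemma fin_supp_bound (f : nat -> R) : fin_supp N f ->
  f 0%N = 0%R /\ exists2 K, state N K & forall i, (K < i)%N -> f i = 0%R.
Proof.
move=> [fN fin]; split; first exact: fN.
have [[p Np]|Nnone] : (exists p, N = Some p) \/ N = None.
  by case: N; [left; eexists|right].
  exists p; first by rewrite Np /state leqnn; move: hN; rewrite Np => ->.
  by move=> i pi; apply: fN; rewrite Np /state (leqNgt i) pi andbF.
have /finite_seqP[s sE] := fin.
(* The successor makes this a state even when the support is empty. *)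
exists (\max_(i <- s) i).+1; first by rewrite Nnone.
move=> i si; apply: contrapT => /eqP fi.
have is_ : i \in s by have : [set` s]%classic i by rewrite -sE.
by have := @leq_bigmax_seq _ s xpredT id i is_ isT; lia.
Qed.

Lemma lambda0_ge0 : 0 <= lambda0 N a b.
Proof.
apply: le_ereal_inf_tmp => _ [f [/fin_supp_bound[f0 [K NK fK]] _] <-].
rewrite (dirichletE NK)// lee_fin big_nat sumr_ge0// => k /andP[_ kK].
by rewrite mulr_ge0 ?sqr_ge0// ltW// (conductance_gt0 NK).
Qed.

Lemma lambda0_le_trapezoid n m K : (1 <= n <= m)%N -> (m <= K)%N -> state N K ->
  lambda0 N a b <=
  (((phi n)^-1 + (psi_upto K m)^-1) / \sum_(n <= j < m.+1) mu j)%:E.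
Proof.
move=> nm mK NK; have /andP[n1 nm'] := nm.
have Nm : state N m by rewrite (state_le NK)// mK andbT (leq_trans n1).
have mu0 k : (1 <= k <= K)%N -> (0 <= mu k)%R.
  by move=> kK; rewrite ltW// mu_gt0// (state_le NK).
have [f [f0 fK Mf Df]] := trapezoid_test_function nm mK
  (fun k => @conductance_gt0 K k NK) mu0.
set M := (\sum_(1 <= i < K.+1) _)%R in Mf.
have s0 := sum_mu_gt0 nm Nm; have M0 : (0 < M)%R by exact: lt_le_trans Mf.
pose g i := (f i / Num.sqrt M)%R.
have gK i : (K < i)%N -> g i = 0%R by move=> Ki; rewrite /g fK// mul0r.
have g0 : g 0%N = 0%R by rewrite /g f0 mul0r.
have sM : (Num.sqrt M ^+ 2 = M)%R by rewrite sqr_sqrtr// ltW.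
apply: (@le_trans _ _ (dirichlet N a b g)).
  apply: ereal_inf_lbound; exists g => //; split.
    split.
      move=> i; apply: contraNeq => gi.
      have iK : (i <= K)%N by rewrite leqNgt; apply: contra gi => /gK ->.
      by apply: (state_le NK); rewrite iK lt0n andbT; apply: contra_neq gi => ->.
    apply: (@sub_finite_set _ _ `I_K.+1) => [i /= gi|]; last exact: finite_II.
    by rewrite ltnS leqNgt; apply: contra gi => /gK ->.
  rewrite (mu_sumE NK gK); congr _%:E.
  rewrite -(divff (lt0r_neq0 M0)) {1}/M mulr_suml; apply: eq_bigr => i _.
  by rewrite /g expr_div_n sM mulrA.
rewrite (dirichletE NK)// lee_fin.
have -> : (\sum_(0 <= k < K.+1) conductance k * (g k.+1 - g k) ^+ 2 =
   ((phi n)^-1 + (psi_upto K m)^-1) / M)%R.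
  rewrite -Df mulr_suml; apply: eq_bigr => i _.
  by rewrite /g -mulrBl expr_div_n sM mulrA.
rewrite ler_wpM2l// ?lef_pV2// addr_ge0// invr_ge0 ltW//.
  by rewrite phi_gt0// (state_le Nm).
exact: psi_upto_gt0.
Qed.

Lemma lambda0_le_kappa_inv : lambda0 N a b <= kappa_inv N a b.
Proof.
apply: le_ereal_inf_tmp => _ [n [m [nm Nm ->]]].
rewrite kappa_termE//; have s0 := sum_mu_gt0 nm Nm.
have := @lambda0_le_trapezoid n m _ nm; have := lambda0_ge0.
case: (lambda0 N a b) => [r r0 H|_ H|//]; last by have := H m (leqnn m) Nm.
(* Only [psi_upto K m] depends on [K]; isolating its inverse lets [K] tend to [N] through
   [psi_le]. *)
have {}H K : state N K -> (m <= K)%N ->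
    (r * (\sum_(n <= j < m.+1) mu j) - (phi n)^-1 <= (psi_upto K m)^-1)%R.
  move=> NK mK; rewrite lerBlDl -ler_pdivlMr//.
  by have := H K mK NK; rewrite lee_fin.
rewrite lee_pdivlMr//.
set x := (_ - _)%R in H.
have psiV0 : 0 <= (psi m)^-1 by rewrite inve_ge0 ltW// psi_gt0.
have rE : r%:E * (\sum_(n <= j < m.+1) mu j)%:E = ((phi n)^-1)%:E + x%:E.
  by rewrite -EFinD addrC subrK -EFinM.
rewrite rE leeD2lE//.
(* For positive [x] the goal can be inverted into an upper bound on [psi m]; otherwise the sign of
   [(psi m)^-1] settles it. *)
have [x0|x0] := lerP x 0; first by apply: le_trans psiV0; rewrite lee_fin.
rewrite inve_pge ?inE ?lee_fin ?(ltW x0)//; last by rewrite ltW// psi_gt0.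
apply: psi_le => // K NK mK.
rewrite inver gt_eqF// lee_fin -[leLHS]invrK lef_pV2 ?H// posrE//.
by rewrite invr_gt0 psi_upto_gt0.
Qed.

Lemma kappa_inv_ge0 : 0 <= kappa_inv N a b.
Proof. exact: le_trans lambda0_ge0 lambda0_le_kappa_inv. Qed.

Lemma kappa_inv_le n m : (1 <= n <= m)%N -> state N m ->
  kappa_inv N a b <=
  (((phi n)^-1)%:E + (psi m)^-1) * ((\sum_(n <= j < m.+1) mu j)^-1)%:E.
Proof.
by move=> nm Nm; rewrite -kappa_termE//; apply: ereal_inf_lbound; exists n, m.
Qed.

Lemma kappa_inv_lty : kappa_inv N a b < +oo.
Proof.
apply: (le_lt_trans (@kappa_inv_le 1 1 isT state1)).
have := psi_gt0 state1; case: (psi 1) => // [r|_]; last by rewrite invey adde0 ltry.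
by rewrite lte_fin => r0; rewrite inver gt_eqF// -EFinD -EFinM ltry.
Qed.

Lemma kappa_inv_quarter_le : kappa_inv N a b / 4%:E <= lambda0 N a b.
Proof.
have := kappa_inv_le; have := kappa_inv_ge0; have := kappa_inv_lty.
case: (kappa_inv N a b) => // C _ C0 HC.
apply: le_ereal_inf_tmp => _ [f [/fin_supp_bound[f0 [K NK fK]] muf] <-].
rewrite (mu_sumE NK fK) in muf; case: muf => muf.
rewrite (dirichletE NK f0 fK) inver gt_eqF// -EFinM lee_fin ler_pdivrMr//.
(* Inserting the normalization of [f] makes the inequality homogeneous. *)
rewrite -[leLHS]mulr1 -[X in (_ * X <= _)%R]muf [leRHS]mulrC.
apply: two_sided_hardy => //.
- by move=> k; exact: conductance_gt0.
- by move=> k kK; rewrite ltW// mu_gt0// (state_le NK).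
- move=> n m nm mK; have /andP[n1 nm'] := nm.
  have Nm : state N m by rewrite (state_le NK)// mK andbT (leq_trans n1).
  have s0 := sum_mu_gt0 nm Nm.
  rewrite -ler_pdivlMr// -lee_fin (le_trans (HC n m nm Nm))// EFinM.
  rewrite lee_wpmul2r ?lee_fin ?invr_ge0 ?(ltW s0)// EFinD leeD2l//.
  (* Cutting the chain at [K] lowers the right resistance, so it only raises the terms to be
     compared with [C]. *)
  have p0 := psi_upto_gt0 NK mK.
  have <- : (psi_upto K m)%:E^-1 = ((\sum_(m <= k < K.+1) (conductance k)^-1)^-1)%:E.
    by rewrite inver gt_eqF.
  rewrite lee_pV2 ?inE ?lee_fin ?(ltW p0) ?(ltW (psi_gt0 Nm))//.
  by apply: psi_ge => //; rewrite mK andbT (leq_trans n1).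
- exact: fK.
Qed.

(** * Comparison of [kappa] with [delta_L] and [delta_R] *)

Lemma conductance0V : ((conductance 0)^-1 = (a 1%N)^-1)%R.
Proof. by rewrite /conductance mu1 mul1r. Qed.

(** Detailed balance shifts the index by one; for finite [N] the boundary term of [total_S] is the
    last resistance in [psi 1]. *)
Lemma total_SE : total_S N a b = ((a 1%N)^-1)%:E + psi 1.
Proof.
have g0 i : state N i -> (0 <= (mu i * a i)^-1)%R.
  by move=> Ni; rewrite invr_ge0 ltW// mulr_gt0 ?mu_gt0 ?ha.
rewrite /total_S eseries_state0 /psi.
have [[p Np]|Nnone] : (exists p, N = Some p) \/ N = None.
  by case: N; [left; eexists|right].
  have p1 : (1 <= p)%N by move: hN; rewrite Np.
  have Nst : state N p by rewrite Np /state leqnn p1.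
  have out i : state N i -> (p < i)%N -> False.
    by rewrite Np => /andP[_ ip]; rewrite ltnNge ip.
  rewrite (@eseries_state_finite _ _ _ 1 p)//; last by move=> i Ni /(out i Ni).
  rewrite (@eseries_state_finite _ _ _ 1 p)//; first last.
  - by move=> i Ni /(out i Ni).
  - exact: conductanceV_ge0.
  have := phiE Nst; rewrite sumEFin => -> /=; rewrite {1}Np -!EFinD; congr _%:E.
  rewrite sum_conductanceE// -conductanceE// -conductance0V /phi.
  by rewrite -[RHS]big_ltn// big_nat_recr.
rewrite (@eseries_state_split _ _ _ 1 1)// ?big_nat1 ?mu1 ?mul1r.
rewrite {2}Nnone adde0; congr (_ + _).
rewrite eseries_mkcond [RHS]eseries_mkcond.
rewrite -(@nneseries_addn _ _ 2) -?(@nneseries_addn _ _ 1).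
- apply: eq_eseriesr => i _; rewrite addn2 addn1.
  have Nst k : state N k.+1 by rewrite Nnone.
  by rewrite !Nst mu_aE// conductanceE.
- by move=> i; case: ifP => // /conductanceV_ge0.
- by move=> i; case: ifP => // /g0.
Qed.

Lemma sum_mu_le n m n' m' : (1 <= n')%N -> (n' <= n)%N -> (m <= m')%N -> state N m' ->
  (\sum_(n <= j < m.+1) mu j <= \sum_(n' <= j < m'.+1) mu j)%R.
Proof.
move=> n1 nn mm Nm; rewrite (big_nat_widen _ _ m'.+1)// (big_nat_widenl _ n')//.
rewrite big_mkcond/= big_nat [leRHS]big_nat; apply: ler_sum => i ni.
case: ifP => // _; rewrite ltW// mu_gt0// (state_le Nm)//; lia.
Qed.

Lemma kappa_le x : 0 <= x -> (forall n m, (1 <= n <= m)%N -> state N m ->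
    x^-1 <= (((phi n)^-1)%:E + (psi m)^-1) * ((\sum_(n <= j < m.+1) mu j)^-1)%:E) ->
  kappa N a b <= x.
Proof.
move=> x0 H; rewrite /kappa inve_ple ?inE ?kappa_inv_ge0//.
apply: le_ereal_inf_tmp => _ [n [m [nm Nm ->]]].
by rewrite kappa_termE// H.
Qed.

Lemma kappa_ge x n m : 0 <= x -> (1 <= n <= m)%N -> state N m ->
  (((phi n)^-1)%:E + (psi m)^-1) * ((\sum_(n <= j < m.+1) mu j)^-1)%:E <= x^-1 ->
  x <= kappa N a b.
Proof.
move=> x0 nm Nm H; rewrite /kappa inve_pge ?inE ?kappa_inv_ge0//.
exact: le_trans (kappa_inv_le nm Nm) H.
Qed.

Lemma delta_L_ge n : state N n ->
  (phi n)%:E * \sum_(n <= j <oo | state N j) (mu j)%:E <= delta_L N a b.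
Proof.
by move=> Nn; apply: ereal_sup_ubound; exists n => //; rewrite phiE.
Qed.

Lemma delta_R_ge m : state N m ->
  (\sum_(1 <= j < m.+1) mu j)%:E * psi m <= delta_R N a b.
Proof.
by move=> Nm; apply: ereal_sup_ubound; exists m => //; rewrite sumEFin.
Qed.

Lemma mu_ge0 j : state N j -> (0 <= mu j)%R.
Proof. by move=> Nj; rewrite ltW// mu_gt0. Qed.

(** Without [(psi m)^-1], a term of [kappa_inv] is the inverse of [phi n] times the mass of the
    interval. *)
Lemma kappa_le_delta_L : kappa N a b <= delta_L N a b.
Proof.
have bound n m : (1 <= n <= m)%N -> state N m ->
    (phi n * \sum_(n <= j < m.+1) mu j)%:E <= delta_L N a b.
  move=> nm Nm; have Nn : state N n by rewrite (state_le Nm).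
  apply: le_trans (delta_L_ge Nn).
  rewrite EFinM lee_wpmul2l ?lee_fin ?(ltW (phi_gt0 Nn))//.
  apply: eseries_state_ge => //; last exact: mu_ge0.
  by move: nm => /andP[-> /leqW].
have d0 : 0 <= delta_L N a b.
  apply: le_trans (bound 1%N 1%N isT state1).
  by rewrite lee_fin mulr_ge0 ?ltW ?phi_gt0 ?sum_mu_gt0// state1.
apply: kappa_le => // n m nm Nm.
have Nn : state N n by rewrite (state_le Nm).
have p0 := phi_gt0 Nn; have s0 := sum_mu_gt0 nm Nm.
apply: (@le_trans _ _ (phi n * \sum_(n <= j < m.+1) mu j)%:E^-1).
  by rewrite lee_pV2 ?bound ?inE// lee_fin mulr_ge0 ?ltW.
rewrite inver gt_eqF ?mulr_gt0// invfM EFinM.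
apply: lee_wpmul2r; first by rewrite lee_fin invr_ge0 ltW.
by rewrite leeDl// inve_ge0 ltW// psi_gt0.
Qed.

(** Here [(phi n)^-1] is dropped and the interval is enlarged to start at 1. *)
Lemma kappa_le_delta_R : kappa N a b <= delta_R N a b.
Proof.
have bound n m : (1 <= n <= m)%N -> state N m ->
    (\sum_(n <= j < m.+1) mu j)%:E * psi m <= delta_R N a b.
  move=> nm Nm; apply: le_trans (delta_R_ge Nm).
  apply: lee_wpmul2r; first by rewrite ltW ?psi_gt0.
  rewrite lee_fin sum_mu_le//; by move: nm => /andP[].
have psi_ge0 m : state N m -> 0 <= psi m by move=> /psi_gt0/ltW.
have d0 : 0 <= delta_R N a b.
  apply: le_trans (bound 1%N 1%N isT state1).
  by apply: mule_ge0; [rewrite lee_fin ltW ?sum_mu_gt0 ?state1|rewrite psi_ge0 ?state1].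
apply: kappa_le => // n m nm Nm.
have Nn : state N n by rewrite (state_le Nm).
have p0 := phi_gt0 Nn; have s0 := sum_mu_gt0 nm Nm.
apply: (@le_trans _ _ ((\sum_(n <= j < m.+1) mu j)%:E * psi m)^-1).
  rewrite lee_pV2 ?bound ?inE//.
  by apply: mule_ge0; [rewrite lee_fin ltW|exact: psi_ge0].
rewrite inveM; last first.
  move: (psi_gt0 Nm); case: (psi m) => //= r r0.
  by rewrite /inveM_def (ltW s0) -lee_fin (ltW r0) !implybT.
rewrite inver gt_eqF// muleC.
apply: lee_wpmul2r; first by rewrite lee_fin invr_ge0 ltW.
by rewrite leeDr// lee_fin invr_ge0 ltW.
Qed.

Lemma psi_split m : state N m ->
  psi 1 = (\sum_(1 <= k < m) (conductance k)^-1)%:E + psi m.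
Proof.
move=> Nm; have m1 := state_gt0 Nm; rewrite /psi.
rewrite (nneseries_split_cond 1 (m - 1)) ?subnKC//; last first.
  by move=> k Nk; rewrite lee_fin conductanceV_ge0.
congr (_ + _); rewrite sumEFin -sum_conductanceE//; congr _%:E.
rewrite big_nat_cond [RHS]big_nat; apply: eq_bigl => i.
by rewrite andb_idr// => im; rewrite (state_le Nm)//; lia.
Qed.

Lemma delta_L_le_kappa : total_S N a b = +oo -> delta_L N a b <= kappa N a b.
Proof.
rewrite total_SE => Sy; have {}Sy : psi 1 = +oo by move: Sy; case: (psi 1).
have psiy m : state N m -> psi m = +oo.
  (* Removing finitely many finite resistances leaves an infinite tail. *)
  by move=> Nm; move: (psi_split Nm); rewrite Sy; case: (psi m).
apply: ge_ereal_sup => _ [n /= Nn <-].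
rewrite phiE// muleC -lee_pdivlMr ?phi_gt0//.
apply: eseries_state_le => //; first exact: mu_ge0.
move=> m nm Nm; rewrite lee_pdivlMr ?phi_gt0// -EFinM.
have n1 := state_gt0 Nn; have nm' : (1 <= n <= m)%N by rewrite n1.
have p0 := phi_gt0 Nn; have s0 := sum_mu_gt0 nm' Nm.
apply: (kappa_ge _ nm' Nm); first by rewrite lee_fin mulr_ge0 ?ltW.
rewrite psiy// invey adde0 inver gt_eqF ?mulr_gt0// invfM -EFinM.
by rewrite mulrC.
Qed.

(** At [n = 1] the numerator of the term is [a 1 + 1 / psi m], that is [(1 + a 1 * psi m) / psi m],
    and [1 + a 1 * psi m <= 1 + a 1 * psi 1 = a 1 * total_S]. *)
Lemma delta_R_le_kappa : total_S N a b != +oo ->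
  ((a 1%N)%:E * total_S N a b)^-1 * delta_R N a b <= kappa N a b.
Proof.
have a1 : (0 < a 1%N)%R by rewrite ha// state1.
rewrite total_SE; have := psi_gt0 state1.
case E : (psi 1) => [r| |]// r0 _; rewrite lte_fin in r0.
have S0 : (0 < a 1%N * ((a 1%N)^-1 + r))%R.
  by rewrite mulr_gt0// addr_gt0 ?invr_gt0.
rewrite -EFinD -EFinM inver gt_eqF// muleC lee_pdivrMr//.
apply: ge_ereal_sup => _ [m /= Nm <-].
have m1 := state_gt0 Nm; have s0 := @sum_mu_gt0 1 m m1 Nm.
rewrite sumEFin -/(psi m) -lee_pdivrMr//.
have := psi_split Nm; have := psi_gt0 Nm.
case Em : (psi m) => [q| |]; rewrite ?E// lte_fin => q0 [] rE.
have qr : (q <= r)%R.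
  rewrite rE lerDr big_nat sumr_ge0// => k /andP[k1 km].
  by rewrite invr_ge0 ltW// (conductance_gt0 Nm)// ltnW.
rewrite -!EFinM; apply: (@kappa_ge _ 1 m) => //.
  by rewrite lee_fin !mulr_ge0 ?invr_ge0 ?ltW.
rewrite Em !inver !gt_eqF ?divr_gt0 ?(mulr_gt0 s0)// -EFinD -EFinM lee_fin.
rewrite /phi big_nat1 conductance0V invrK invf_div invfM.
rewrite [leRHS]mulrC -mulrA [leRHS]mulrC ler_pM2r ?invr_gt0//.
rewrite mulrDr divff ?gt_eqF// mulrC ler_pdivlMr// mulrDl mulVf ?gt_eqF//.
by rewrite addrC lerD2l ler_pM2l.
Qed.

End BirthDeathBounds.

Theorem corollary7p3 (R : realType) (N : option nat)
    (hN : if N is Some n then (1 <= n)%N else true)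
    (a b : nat -> R)
    (ha : forall i : nat, state N i -> (0 < a i)%R)
    (hb : forall i : nat, state N i -> (0 < b i)%R) :
  (kappa_inv N a b / 4%:E <= lambda0 N a b /\
   lambda0 N a b <= kappa_inv N a b) /\
  (kappa N a b <= Order.min (delta_L N a b) (delta_R N a b) /\
   ((if total_S N a b == +oo then 1 else 0) + ((a 1%N)%:E * total_S N a b)^-1)
     * Order.min (delta_L N a b) (delta_R N a b) <= kappa N a b).
Proof.
split; first by split; [exact: kappa_inv_quarter_le|exact: lambda0_le_kappa_inv].
split; first by rewrite le_min kappa_le_delta_L ?kappa_le_delta_R.
(* The prefactor is 1 when [total_S] is infinite, its second summand being the inverse of [+oo];
   otherwise only that summand remains. *)
case: eqP => [Sy|/eqP Sy].
  rewrite Sy gt0_muley ?lte_fin ?ha ?state1// invey adde0 mul1e.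
  by rewrite ge_min delta_L_le_kappa.
rewrite add0e; apply: le_trans (delta_R_le_kappa hN ha hb Sy).
apply: lee_wpmul2l; last by rewrite ge_min lexx orbT.
rewrite inve_ge0 mule_ge0// ?lee_fin ?ltW ?ha ?state1//.
by rewrite total_SE// adde_gt0 ?psi_gt0 ?state1// lte_fin invr_gt0 ha ?state1.
Qed.
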